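(* Let $X,Z$ be pointed metric spaces and let $q\colon X\to Z$ be a base-point preserving Lipschitz quotient that is $1$-Lipschitz and $C$-co-Lipschitz for every $C>1$. Let $E,F$ be Banach spaces over $\mathbb{K}$ and $Q\colon E\to F$ a quotient operator. Then $q\boxtimes_\pi Q\colon X\widehat{\boxtimes}_\pi E\to Z\widehat{\boxtimes}_\pi F$ is a quotient operator.
   Context: $\mathbb{K}$ is $\mathbb{R}$ or $\mathbb{C}$. A pointed metric space $X$ is a metric space (with metric $d$) with a distinguished base point $0$. For pointed metric spaces $X,Y$ (a Banach space being pointed by its zero vector), $\mathrm{Lip}_0(X,Y)$ is the set of all Lipschitz maps $f\colon X\to Y$ with $f(0)=0$, and $\mathrm{Lip}(f)$ is the least Lipschitz constant. $E^*$ is the topological dual of $E$ and $\langle\phi,e\rangle=\phi(e)$; $V'$ denotes the algebraic dual of a vector space $V$. For $x,y\in X$ and $e\in E$, $\delta_{(x,y)}\boxtimes e\in \mathrm{Lip}_0(X,E^* )'$ is the linear functional $f\mapsto\langle f(x)-f(y),e\rangle$. The Lipschitz tensor product $X\boxtimes E$ is the linear subspace of $\mathrm{Lip}_0(X,E^* )'$ spanned by all the functionals $\delta_{(x,y)}\boxtimes e$ with $x,y\in X$, $e\in E$. Every $u\in X\boxtimes E$ can be written (non-uniquely) as $u=\sum_{i=1}^n\delta_{(x_i,y_i)}\boxtimes e_i$. For $u\in X\boxtimes E$, the Lipschitz projective norm is $$\pi(u)=\inf\left\{\sum_{i=1}^n d(x_i,y_i)\|e_i\|\colon u=\sum_{i=1}^n\delta_{(x_i,y_i)}\boxtimes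 e_i\right\},$$ the infimum being over all representations of $u$; $X\widehat{\boxtimes}_{\pi}E$ is the completion of $X\boxtimes E$ with the norm $\pi$. For $h\in\mathrm{Lip}_0(X,Z)$ and a bounded linear operator $T\colon E\to F$, the linear map $h\boxtimes T\colon X\boxtimes E\to Z\boxtimes F$, $\sum_{i=1}^n\delta_{(x_i,y_i)}\boxtimes e_i\mapsto\sum_{i=1}^n\delta_{(h(x_i),h(y_i))}\boxtimes T(e_i)$, is well defined and bounded for the norms $\pi$, and $h\boxtimes_\pi T\colon X\widehat{\boxtimes}_\pi E\to Z\widehat{\boxtimes}_\pi F$ denotes its unique bounded linear extension. A Lipschitz map $f\colon X\to Z$ is $C$-co-Lipschitz if $f(B(x,r))\supset B(f(x),r/C)$ for every $x\in X$ and $r>0$ (where $B(\cdot,\cdot)$ denotes a ball). It is a Lipschitz quotient if it is surjective, Lipschitz and co-Lipschitz (i.e. $C$-co-Lipschitz for some $C$). A bounded linear operator $Q\colon E\to F$ between Banach spaces is a quotient operator if it is surjective and $\|y\|=\inf\{\|x\|\colon Q(x)=y\}$ for every $y\in F$. *)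

(* Defs.v *)
From HB Require Import structures.
From mathcomp Require Import all_boot all_order all_algebra.
From mathcomp Require Import complex.
From mathcomp Require Import mathcomp_extra boolp classical_sets functions reals.
From mathcomp Require Import topology normedtype sequences.

Set Implicit Arguments.
Unset Strict Implicit.
Unset Printing Implicit Defensive.

Import Order.TTheory GRing.Theory Num.Theory.
Import numFieldNormedType.Exports.

Local Open Scope classical_set_scope.
Local Open Scope ring_scope.

Variant scalar_kind := RealScalars | ComplexScalars.

Definition scalars (R : realType) (k : scalar_kind) : numFieldType :=
  match k with
  | RealScalars => R
  | ComplexScalars => R[i]
  end.

(* In MathComp-Analysis the norm of a normed space over K takes its values
   in K; [sre] and [sof] pass between these values and the reals. *)
Definition sre (R : realType) (k : scalar_kind) : scalars R k -> R :=
  match k return scalars R k -> R with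
  | RealScalars => id
  | ComplexScalars => fun z => complex.Re z
  end.

Definition sof (R : realType) (k : scalar_kind) : R -> scalars R k :=
  match k return R -> scalars R k with
  | RealScalars => id
  | ComplexScalars => fun r => (r%:C)%C
  end.

Arguments sof {R} k.

Section scalars_theory.
Context (R : realType) (k : scalar_kind).
Local Notation K := (scalars R k).

Lemma sofK : cancel (sof k) (@sre R k).
Proof. by case: k. Qed.

Lemma sof0 : sof k (0 : R) = 0.
Proof. by case: k. Qed.

Lemma sof1 : sof k (1 : R) = 1.
Proof. by case: k. Qed.

Lemma sofD (x y : R) : sof k (x + y) = sof k x + sof k y.
Proof. by case: k => //=; rewrite rmorphD. Qed.

Lemma sofM (x y : R) : sof k (x * y) = sof k x * sof k y.
Proof. by case: k => //=; rewrite rmorphM. Qed.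

Lemma ler_sof (x y : R) : (sof k x <= sof k y) = (x <= y).
Proof. by case: k => //=; rewrite lecR. Qed.

Lemma ltr_sof (x y : R) : (sof k x < sof k y) = (x < y).
Proof. by case: k => //=; rewrite ltcR. Qed.

Lemma sreK (x : K) : 0 <= x -> sof k (sre x) = x.
Proof.
move: x; case: k => //= -[a b]; rewrite lecE /= => /andP[/eqP -> _].
by [].
Qed.

End scalars_theory.

Section nrm.
Context (R : realType) (k : scalar_kind).
Local Notation K := (scalars R k).

Definition nrm (V : normedModType K) (v : V) : R := sre `|v|.

Lemma nrmE (V : normedModType K) (v : V) : `|v| = sof k (nrm v).
Proof. by rewrite sreK. Qed.

Lemma nrm_ge0 (V : normedModType K) (v : V) : 0 <= nrm v.
Proof. by rewrite -(ler_sof k) sof0 -nrmE. Qed.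

Lemma nrmD (V : normedModType K) (v w : V) : nrm (v + w) <= nrm v + nrm w.
Proof. by rewrite -(ler_sof k) sofD -!nrmE ler_normD. Qed.

Lemma nrmZ (V : normedModType K) (a : K) (v : V) :
  nrm (a *: v) = nrm (a : K^o) * nrm v.
Proof. by apply: (can_inj (@sofK R k)); rewrite sofM -!nrmE normrZ. Qed.

Lemma nrmN (V : normedModType K) (v : V) : nrm (- v) = nrm v.
Proof. by rewrite /nrm normrN. Qed.

Lemma nrm0 (V : normedModType K) : nrm (0 : V) = 0.
Proof. by apply: (can_inj (@sofK R k)); rewrite -nrmE normr0 sof0. Qed.

Lemma nrm1 : nrm (1 : K^o) = 1.
Proof. by apply: (can_inj (@sofK R k)); rewrite -nrmE normr1 sof1. Qed.

Lemma nrm_eq0 (V : normedModType K) (v : V) : nrm v = 0 -> v = 0.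
Proof. by move=> v0; apply: normr0_eq0; rewrite nrmE v0 sof0. Qed.

Lemma nrm_sof (r : R) : 0 <= r -> nrm (sof k r : K^o) = r.
Proof.
move=> r0; apply: (can_inj (@sofK R k)); rewrite -nrmE ger0_norm //.
by rewrite -(sof0 R k) ler_sof.
Qed.

Definition bounded_op (V W : normedModType K) (f : V -> W) : Prop :=
  linear f /\ exists M : R, forall v, nrm (f v) <= M * nrm v.

Lemma bounded_opP (V W : normedModType K) (f : V -> W) :
  bounded_op f <-> linear f /\ continuous f.
Proof.
split=> -[lf]; set g : {linear V -> W} :=
    HB.pack f (GRing.isLinear.Build K V W *:%R f lf).
  move=> [M fM]; split=> //.
  rewrite -[f]/(g : V -> W).
  apply: (iffLR (linear_bounded_continuous g)); apply/linear_boundedP.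
  have Mr : sof k `|M| \is Num.real.
    by apply: ger0_real; rewrite -(sof0 R k) ler_sof.
  near=> r => x /=.
  apply: (@le_trans _ _ (sof k `|M| * `|x|)).
    rewrite !nrmE -sofM ler_sof (le_trans (fM x))// ler_wpM2r ?nrm_ge0//.
    exact: ler_norm.
  by rewrite ler_wpM2r//; near: r; apply: nbhs_pinfty_ge.
move=> cf; split=> //.
have /linear_boundedP/pinfty_ex_gt0[r r0 fr] :=
  iffRL (linear_bounded_continuous g) cf.
exists (sre r) => v; rewrite -(ler_sof k) sofM sreK ?(ltW r0)// -!nrmE.
exact: fr.
Unshelve. all: by end_near. Qed.

Definition opnorm (V W : normedModType K) (f : V -> W) : R :=
  sup [set nrm (f v) | v in [set v | nrm v <= 1]].

Section opnorm_theory.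
Context (V W : normedModType K) (f : V -> W).

Lemma opnorm_le (M : R) : linear f -> (forall v, nrm (f v) <= M * nrm v) ->
  0 <= M -> opnorm f <= M.
Proof.
move=> lf fM M0; apply: ge_sup.
  by exists (nrm (f 0)), 0 => //=; rewrite nrm0.
by move=> _ [v /= v1 <-]; rewrite (le_trans (fM v))// ler_piMr.
Qed.

Lemma le_opnorm v : bounded_op f -> nrm (f v) <= opnorm f * nrm v.
Proof.
move=> [lf [M fM]].
have f0 : f 0 = 0.
  by have := lf (-1) 0 0; rewrite scaler0 add0r scaleN1r addNr.
have fZ a u : f (a *: u) = a *: f u by rewrite -[a *: u]addr0 lf f0 addr0.
have [v0|v0] := eqVneq (nrm v) 0.
  by rewrite (nrm_eq0 v0) f0 !nrm0 mulr0.
have vgt0 : 0 < nrm v by rewrite lt_neqAle eq_sym v0 nrm_ge0.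
rewrite -ler_pdivrMr//.
have ninv : nrm (sof k (nrm v)^-1 : K^o) = (nrm v)^-1.
  by rewrite nrm_sof// invr_ge0 nrm_ge0.
apply: ub_le_sup.
  exists `|M| => _ [u /= u1 <-]; rewrite (le_trans (fM u))//.
  apply: (@le_trans _ _ (`|M| * nrm u)); last by rewrite ler_piMr.
  by rewrite ler_wpM2r ?nrm_ge0// ler_norm.
exists (sof k (nrm v)^-1 *: v) => /=.
  by rewrite nrmZ ninv mulVf.
by rewrite fZ nrmZ ninv mulrC.
Qed.

Lemma opnorm_ge0 : bounded_op f -> 0 <= opnorm f.
Proof.
move=> [lf [M fM]]; apply: (@le_trans _ _ (nrm (f 0))); first exact: nrm_ge0.
apply: ub_le_sup; last by exists 0 => //=; rewrite nrm0.
exists `|M| => _ [u /= u1 <-]; rewrite (le_trans (fM u))//.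
apply: (@le_trans _ _ (`|M| * nrm u)); last by rewrite ler_piMr.
by rewrite ler_wpM2r ?nrm_ge0// ler_norm.
Qed.

End opnorm_theory.

Definition quotient_operator (V W : normedModType K) (f : V -> W) : Prop :=
  [/\ bounded_op f, set_surj setT setT f &
      forall w, nrm w = inf [set nrm v | v in [set v | f v = w]]].

End nrm.

#[short(type="pointedMetricType")]
HB.structure Definition PointedMetric (K : numDomainType) :=
  {T of Metric K T & isPointed T}.

Section lipschitz.
Context (R : realType).

Definition lipschitz_with (X Y : Type) (dX : X -> X -> R) (dY : Y -> Y -> R)
  (L : R) (f : X -> Y) : Prop := forall x y, dY (f x) (f y) <= L * dX x y.

Definition lipschitz_map (X Z : metricType R) (L : R) (f : X -> Z) : Prop :=
  lipschitz_with (@mdist R X) (@mdist R Z) L f.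

Definition co_lipschitz (X Z : metricType R) (C : R) (f : X -> Z) : Prop :=
  forall x r, 0 < r -> ball (f x) (r / C) `<=` f @` ball x r.

Definition lipschitz_quotient (X Z : metricType R) (f : X -> Z) : Prop :=
  [/\ set_surj setT setT f, exists L, lipschitz_map L f &
      exists2 C, 0 < C & co_lipschitz C f].

End lipschitz.

Section dual.
Context (R : realType) (k : scalar_kind).
Local Notation K := (scalars R k).
Variable E : normedModType K.

Definition dual_pred : {pred E -> K^o} :=
  fun f => `[< linear f /\ continuous f >].

Record dual := Dual { dual_fun :> E -> K^o; _ : dual_fun \in dual_pred }.

HB.instance Definition _ := [isSub for dual_fun].
HB.instance Definition _ := [Choice of dual by <:].

Lemma dual_pred_closed : submod_closed dual_pred.
Proof.
split=> [|a f g /asboolP[lf cf] /asboolP[lg cg]]; apply/asboolP.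
  split; last exact: cst_continuous.
  by move=> b u v; rewrite scaler0 addr0.
split=> [b u v|x].
  by rewrite /= !fctE lf lg !scalerDr !scalerA (mulrC b a) addrACA.
apply: (@continuousD K K^o E (fun x => a *: f x) g x); last exact: cg.
apply: (@continuousZl_tmp K K^o E); exact: cf.
Qed.

HB.instance Definition _ :=
  GRing.isSubmodClosed.Build K (E -> K^o) dual_pred dual_pred_closed.
HB.instance Definition _ := [SubChoice_isSubLmodule of dual by <:].

Lemma dual_linE a (f g : dual) e :
  dual_fun (a *: f + g) e = a *: f e + g e.
Proof. by []. Qed.

Lemma dual_bounded (f : dual) : bounded_op f.
Proof. by apply/bounded_opP/asboolP; exact: (valP f). Qed.

Lemma dual_homZ (f : dual) a e : f (a *: e) = a *: f e.
Proof.
have [lf _] := dual_bounded f.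
have f0 : f 0 = 0.
  by have := lf (-1) 0 0; rewrite scaler0 add0r scaleN1r addNr.
by have := lf a e 0; rewrite !addr0 f0 addr0.
Qed.

Definition dual_norm (f : dual) : R := opnorm f.

Lemma dual_norm_bound (f : dual) e : nrm (f e) <= dual_norm f * nrm e.
Proof. exact/le_opnorm/dual_bounded. Qed.

Lemma dual_norm_ge0 (f : dual) : 0 <= dual_norm f.
Proof. exact/opnorm_ge0/dual_bounded. Qed.

Lemma dual_norm_le (f : dual) (M : R) :
  (forall e, nrm (f e) <= M * nrm e) -> 0 <= M -> dual_norm f <= M.
Proof. by apply: opnorm_le; have [] := dual_bounded f. Qed.

Let dualD (f g : dual) :
  sof k (dual_norm (f + g)) <= sof k (dual_norm f) + sof k (dual_norm g).
Proof.
rewrite -sofD ler_sof; apply: dual_norm_le => [e|].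
  by rewrite mulrDl (le_trans (nrmD _ _))// lerD// dual_norm_bound.
by rewrite addr_ge0// dual_norm_ge0.
Qed.

Let dualZ (a : K) (f : dual) :
  sof k (dual_norm (a *: f)) = `|a| * sof k (dual_norm f).
Proof.
have leZ b (g : dual) : dual_norm (b *: g) <= nrm (b : K^o) * dual_norm g.
  apply: dual_norm_le => [e|].
    by rewrite nrmZ -mulrA ler_wpM2l ?nrm_ge0// dual_norm_bound.
  by rewrite mulr_ge0 ?nrm_ge0 ?dual_norm_ge0.
rewrite (@nrmE R k K^o a) -sofM; congr (sof k _); apply/eqP; rewrite eq_le leZ/=.
have [->|a0] := eqVneq a 0; first by rewrite nrm0 mul0r dual_norm_ge0.
have na0 : 0 < nrm (a : K^o).
  rewrite lt_neqAle nrm_ge0 andbT eq_sym; apply: contra_neq a0.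
  exact: (@nrm_eq0 R k K^o).
have := leZ a^-1 (a *: f); rewrite scalerA mulVf// scale1r.
rewrite -(ler_pM2l na0) mulrA -nrmZ /GRing.scale/= mulfV//.
by rewrite nrm1 mul1r.
Qed.

Let dual0 (f : dual) : sof k (dual_norm f) = 0 -> f = 0.
Proof.
rewrite -(sof0 R k) => /(can_inj (@sofK R k)) f0; apply/val_inj/funext => e.
apply: (@nrm_eq0 R k K^o); apply/eqP; rewrite eq_le nrm_ge0 andbT.
by have := dual_norm_bound f e; rewrite f0 mul0r.
Qed.

HB.instance Definition _ := Lmodule_isNormed.Build K dual dualD dualZ dual0.

Lemma nrm_dualE (f : dual) : nrm f = dual_norm f.
Proof. by rewrite /nrm -[`|f|]/(sof k (dual_norm f)) sofK. Qed.

End dual.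

Section lip0.
Context (R : realType) (k : scalar_kind).
Local Notation K := (scalars R k).
Variables (X : pointedMetricType R) (V : normedModType K).

Definition lip0_pred : {pred X -> V} := fun f =>
  `[< f point = 0 /\
      exists L, lipschitz_with (@mdist R X) (fun v w => nrm (v - w)) L f >].

Record lip0 := Lip0 { lip0_fun :> X -> V; _ : lip0_fun \in lip0_pred }.

HB.instance Definition _ := [isSub for lip0_fun].
HB.instance Definition _ := [Choice of lip0 by <:].

Lemma lip0_pred_closed : submod_closed lip0_pred.
Proof.
split=> [|a f g /asboolP[f0 [L fL]] /asboolP[g0 [M gM]]]; apply/asboolP.
  by split=> //; exists 0 => x y; rewrite subrr nrm0 mul0r.
split; first by rewrite /= !fctE f0 g0 scaler0 addr0.
exists (nrm (a : K^o) * L + M) => x y.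
rewrite /= !fctE opprD addrACA -scalerBr (le_trans (nrmD _ _))// mulrDl.
by rewrite lerD// nrmZ -mulrA ler_wpM2l// nrm_ge0.
Qed.

HB.instance Definition _ :=
  GRing.isSubmodClosed.Build K (X -> V) lip0_pred lip0_pred_closed.
HB.instance Definition _ := [SubChoice_isSubLmodule of lip0 by <:].

Lemma lip0_linE a (f g : lip0) x :
  lip0_fun (a *: f + g) x = a *: f x + g x.
Proof. by []. Qed.

End lip0.

Section alg_dual.
Context (K : numFieldType) (V : lmodType K).

Definition alg_dual_pred : {pred V -> K^o} := fun f => `[< linear f >].

Record alg_dual :=
  AlgDual { alg_dual_fun :> V -> K^o; _ : alg_dual_fun \in alg_dual_pred }.

HB.instance Definition _ := [isSub for alg_dual_fun].
HB.instance Definition _ := [Choice of alg_dual by <:].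

Lemma alg_dual_pred_closed : submod_closed alg_dual_pred.
Proof.
split=> [|a f g /asboolP lf /asboolP lg]; apply/asboolP => b u v.
  by rewrite scaler0 addr0.
by rewrite /= !fctE lf lg !scalerDr !scalerA (mulrC b a) addrACA.
Qed.

HB.instance Definition _ :=
  GRing.isSubmodClosed.Build K (V -> K^o) alg_dual_pred alg_dual_pred_closed.
HB.instance Definition _ := [SubChoice_isSubLmodule of alg_dual by <:].

End alg_dual.

Section lip_tensor.
Context (R : realType) (k : scalar_kind).
Local Notation K := (scalars R k).
Variables (X : pointedMetricType R) (E : normedModType K).
Local Notation Lip0XE := (lip0 X (dual E)).

Lemma delta_box_subproof (x y : X) (e : E) :
  (fun f : Lip0XE => dual_fun (f x - f y) e) \in @alg_dual_pred K Lip0XE.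
Proof.
apply/asboolP => a f g; rewrite !lip0_linE opprD addrACA -scalerBr.
by rewrite dual_linE.
Qed.

Definition delta_box (x y : X) (e : E) : alg_dual Lip0XE :=
  AlgDual (delta_box_subproof x y e).

Definition lip_tensor_pred : {pred alg_dual Lip0XE} := fun u =>
  `[< exists s : seq (K * (X * X * E)),
        u = \sum_(t <- s) t.1 *: delta_box t.2.1.1 t.2.1.2 t.2.2 >].

Record lip_tensor := LipTensor
  { lip_tensor_val :> alg_dual Lip0XE; _ : lip_tensor_val \in lip_tensor_pred }.

HB.instance Definition _ := [isSub for lip_tensor_val].
HB.instance Definition _ := [Choice of lip_tensor by <:].

Lemma lip_tensor_pred_closed : submod_closed lip_tensor_pred.
Proof.
split=> [|a u v /asboolP[s ->] /asboolP[t ->]]; apply/asboolP.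
  by exists [::]; rewrite big_nil.
exists ([seq (a * z.1, z.2) | z <- s] ++ t); rewrite big_cat big_map/=.
by rewrite scaler_sumr; congr (_ + _); apply: eq_bigr => z _; rewrite scalerA.
Qed.

HB.instance Definition _ := GRing.isSubmodClosed.Build K (alg_dual Lip0XE)
  lip_tensor_pred lip_tensor_pred_closed.
HB.instance Definition _ := [SubChoice_isSubLmodule of lip_tensor by <:].

Lemma box_subproof (x y : X) (e : E) : delta_box x y e \in lip_tensor_pred.
Proof.
by apply/asboolP; exists [:: (1, (x, y, e))]; rewrite big_seq1 scale1r.
Qed.

Definition box (x y : X) (e : E) : lip_tensor := LipTensor (box_subproof x y e).

Definition rep (s : seq (X * X * E)) : lip_tensor :=
  \sum_(t <- s) box t.1.1 t.1.2 t.2.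

Lemma repE (s : seq (X * X * E)) (f : Lip0XE) :
  rep s f = \sum_(t <- s) dual_fun (f t.1.1 - f t.1.2) t.2.
Proof.
rewrite /rep; elim: s => [|t s IH]; first by rewrite !big_nil.
by rewrite !big_cons -IH.
Qed.

Lemma rep_surj (u : lip_tensor) : exists s, rep s = u.
Proof.
case: u => u up; have /asboolP[s us] := up.
exists [seq (t.2.1, t.1 *: t.2.2) | t <- s].
apply/val_inj/val_inj/funext => f; rewrite [LHS]repE -[RHS]/(alg_dual_fun u f) us big_map.
elim: s {u up us} => [|t s IH]; first by rewrite !big_nil.
rewrite !big_cons IH; congr (_ + _).
exact: dual_homZ.
Qed.

Definition rep_weight (s : seq (X * X * E)) : R :=
  \sum_(t <- s) mdist t.1.1 t.1.2 * nrm t.2.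

Definition lip_pi (u : lip_tensor) : R :=
  inf [set rep_weight s | s in [set s | rep s = u]].

End lip_tensor.

Section lip_pi_norm.
Context (R : realType) (k : scalar_kind).
Local Notation K := (scalars R k).
Variables (X : pointedMetricType R) (E : normedModType K).
Local Notation T := (lip_tensor X E).

Lemma rep_weight_ge0 (s : seq (X * X * E)) : 0 <= rep_weight s.
Proof. by apply: sumr_ge0 => t _; rewrite mulr_ge0 ?nrm_ge0// mdist_ge0. Qed.

Lemma lip_pi_le (s : seq (X * X * E)) (u : T) :
  rep s = u -> lip_pi u <= rep_weight s.
Proof.
move=> su; apply: ge_inf; last by exists s.
by exists 0 => _ [t _ <-]; exact: rep_weight_ge0.
Qed.

Lemma le_lip_pi (M : R) (u : T) :
  (forall s, rep s = u -> M <= rep_weight s) -> M <= lip_pi u.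
Proof.
move=> Mu; apply: lb_le_inf.
  by have [s su] := rep_surj u; exists (rep_weight s), s.
by move=> _ [s /= su <-]; exact: Mu.
Qed.

Lemma lip_pi_ge0 (u : T) : 0 <= lip_pi u.
Proof. by apply: le_lip_pi => s _; exact: rep_weight_ge0. Qed.

Let lip_piD (u v : T) :
  sof k (lip_pi (u + v)) <= sof k (lip_pi u) + sof k (lip_pi v).
Proof.
rewrite -sofD ler_sof -lerBlDr; apply: le_lip_pi => s su.
rewrite lerBlDr -lerBlDl; apply: le_lip_pi => t tv.
rewrite lerBlDl -[leRHS]big_cat.
by apply: lip_pi_le; rewrite /rep big_cat /= -su -tv.
Qed.

Lemma rep_scale (a : K) (s : seq (X * X * E)) :
  rep [seq (t.1, a *: t.2) | t <- s] = a *: (rep s : T).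
Proof.
apply/val_inj/val_inj/funext => f.
transitivity (a *: (rep s : T) f); last by [].
rewrite [LHS]repE big_map repE scaler_sumr; apply: eq_bigr => t _.
exact: dual_homZ.
Qed.

Let lip_piZ (a : K) (u : T) :
  sof k (lip_pi (a *: u)) = `|a| * sof k (lip_pi u).
Proof.
have leZ b (v : T) : lip_pi (b *: v) <= nrm (b : K^o) * lip_pi v.
  have [->|b0] := eqVneq b 0.
    rewrite nrm0 mul0r scale0r.
    have r0 : rep [::] = 0 :> T by rewrite /rep big_nil.
    by have := lip_pi_le r0; rewrite /rep_weight big_nil.
  have nb0 : 0 < nrm (b : K^o).
    rewrite lt_neqAle nrm_ge0 andbT eq_sym; apply: contra_neq b0.
    exact: (@nrm_eq0 R k K^o).
  rewrite mulrC -ler_pdivrMr//; apply: le_lip_pi => s sv; rewrite ler_pdivrMr//.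
  have := lip_pi_le (rep_scale b s); rewrite sv => /le_trans; apply.
  rewrite /rep_weight big_map mulr_suml; apply: ler_sum => t _ /=.
  by rewrite nrmZ [nrm _ * nrm _]mulrC mulrA.
rewrite (@nrmE R k K^o a) -sofM; congr (sof k _); apply/eqP; rewrite eq_le leZ/=.
have [->|a0] := eqVneq a 0; first by rewrite nrm0 mul0r lip_pi_ge0.
have na0 : 0 < nrm (a : K^o).
  rewrite lt_neqAle nrm_ge0 andbT eq_sym; apply: contra_neq a0.
  exact: (@nrm_eq0 R k K^o).
have := leZ a^-1 (a *: u); rewrite scalerA mulVf// scale1r.
rewrite -(ler_pM2l na0) mulrA -nrmZ /GRing.scale/= mulfV//.
by rewrite nrm1 mul1r.
Qed.

Let lip_pi0 (u : T) : sof k (lip_pi u) = 0 -> u = 0.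
Proof.
rewrite -(sof0 R k) => /(can_inj (@sofK R k)) u0.
apply/val_inj/val_inj/funext => f; apply: (@nrm_eq0 R k K^o).
have /asboolP[_ [L fL]] := valP f.
have {}fL x y : dual_norm (f x - f y) <= `|L| * mdist x y.
  rewrite -nrm_dualE (le_trans (fL x y))// ler_wpM2r ?mdist_ge0//.
  exact: ler_norm.
have uf : nrm (u f : K^o) <= `|L| * lip_pi u.
  have [L0|L0] := eqVneq `|L| 0.
    have [s <-] := rep_surj u; rewrite repE L0 mul0r.
    apply: (@le_trans _ _ (\sum_(t <- s) (0:R))); last by rewrite big1_eq.
    elim: s => [|t s IH]; first by rewrite !big_nil nrm0.
    rewrite !big_cons (le_trans (nrmD _ _))// lerD//.
    rewrite (le_trans (dual_norm_bound _ _))// mulr_le0_ge0 ?nrm_ge0//.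
    by rewrite (le_trans (fL _ _))// L0 mul0r.
  have Lp : 0 < `|L| by rewrite lt_neqAle eq_sym L0 normr_ge0.
  rewrite mulrC -ler_pdivrMr//; apply: le_lip_pi => s <-; rewrite ler_pdivrMr//.
  rewrite repE /rep_weight.
  elim: s => [|t s IH]; first by rewrite !big_nil nrm0 mul0r.
  rewrite !big_cons (le_trans (nrmD _ _))// mulrDl lerD//.
  rewrite (le_trans (dual_norm_bound _ _))// mulrAC ler_wpM2r ?nrm_ge0//.
  by rewrite mulrC.
by apply/eqP; rewrite eq_le nrm_ge0 andbT; rewrite u0 mulr0 in uf.
Qed.

HB.instance Definition _ := Lmodule_isNormed.Build K T lip_piD lip_piZ lip_pi0.

Lemma nrm_lip_tensorE (u : T) : nrm u = lip_pi u.
Proof. by rewrite /nrm -[`|u|]/(sof k (lip_pi u)) sofK. Qed.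

End lip_pi_norm.

Section completion.
Context (R : realType) (k : scalar_kind).
Local Notation K := (scalars R k).

(* A completion of V is a Banach space together with a linear isometric
   embedding of V with dense range; it is determined up to isometric
   isomorphism, and no particular model is chosen. *)
Record completion (V : normedModType K) := Completion {
  completion_space :> completeNormedModType K;
  completion_emb : V -> completion_space;
  completion_emb_linear : linear completion_emb;
  completion_emb_isometry : forall v, nrm (completion_emb v) = nrm v;
  completion_emb_dense : dense (range completion_emb) }.

Arguments completion_emb {V} _ _.

Section extension.
Context (V : normedModType K) (Vc : completion V) (W : completeNormedModType K).
Variables (T : V -> W) (bT : bounded_op T).

Let linB (U U' : normedModType K) (f : U -> U') : linear f ->
  forall x y, f (x - y) = f x - f y.
Proof. by move=> lf x y; rewrite addrC -scaleN1r lf scaleN1r addrC. Qed.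

Let nrmBD (U : normedModType K) (x y z : U) :
  nrm (x - z) <= nrm (x - y) + nrm (y - z).
Proof. by rewrite (le_trans _ (nrmD _ _))// addrA subrK. Qed.

Let nrmBC (U : normedModType K) (x y : U) : nrm (x - y) = nrm (y - x).
Proof. by rewrite -nrmN opprB. Qed.

Let emb_nrmB u v :
  nrm (completion_emb Vc u - completion_emb Vc v) = nrm (u - v).
Proof.
by rewrite -(linB (completion_emb_linear Vc)) completion_emb_isometry.
Qed.

Let closure_graph (w : Vc) (z : W) := forall e : R, 0 < e ->
  exists2 u, nrm (w - completion_emb Vc u) <= e & nrm (z - T u) <= e.

Let closure_graph_emb u : closure_graph (completion_emb Vc u) (T u).
Proof. by move=> e e0; exists u; rewrite subrr nrm0 ltW. Qed.

Let closure_graph_linear a w z w' z' :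
  closure_graph w z -> closure_graph w' z' ->
  closure_graph (a *: w + w') (a *: z + z').
Proof.
move=> wz wz' e e0; have [lT _] := bT.
have a0 : 0 < nrm (a : K^o) + 1 by rewrite ltr_wpDl// nrm_ge0.
have d0 : 0 < e / 2 / (nrm (a : K^o) + 1) by rewrite !divr_gt0.
have [u wu zu] := wz _ d0; have [u' wu' zu'] := wz' _ (divr_gt0 e0 (ltr0n R 2)).
have bnd (U : normedModType K) (x x' y y' : U) :
    nrm (x - y) <= e / 2 / (nrm (a : K^o) + 1) -> nrm (x' - y') <= e / 2 ->
    nrm (a *: x + x' - (a *: y + y')) <= e.
  move=> xy xy'; rewrite opprD addrACA -scalerBr (le_trans (nrmD _ _))//.
  rewrite [leRHS]splitr lerD// nrmZ.
  apply: (@le_trans _ _ ((nrm (a : K^o) + 1) * nrm (x - y))).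
    by rewrite ler_wpM2r ?nrm_ge0// lerDl.
  by rewrite mulrC -ler_pdivlMr.
exists (a *: u + u').
  by rewrite (completion_emb_linear Vc); exact: bnd.
by rewrite lT; exact: bnd.
Qed.

Let closure_graph_bound (M : R) : 0 <= M ->
  (forall v, nrm (T v) <= M * nrm v) ->
  forall w z, closure_graph w z -> nrm z <= M * nrm w.
Proof.
move=> M0 TM w z wz; apply/ler_addgt0Pr => e e0.
have M1 : 0 < M + 1 by rewrite ltr_wpDl.
have [u wu zu] := wz _ (divr_gt0 e0 M1).
have nu : nrm u <= nrm w + e / (M + 1).
  rewrite -(completion_emb_isometry Vc).
  rewrite -[completion_emb Vc u](subrK w) addrC (le_trans (nrmD _ _))//.
  by rewrite lerD2l nrmBC.
rewrite -[z](subrK (T u)) (le_trans (nrmD _ _))//.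
apply: (@le_trans _ _ (e / (M + 1) + M * (nrm w + e / (M + 1)))).
  by rewrite lerD// (le_trans (TM u))// ler_wpM2l.
rewrite mulrDr addrCA lerD2l -[X in X + _]mul1r -mulrDl (addrC 1) mulrCA.
by rewrite mulfV ?mulr1// gt_eqF.
Qed.

Let approx (w : Vc) (e : R) : 0 < e ->
  exists u, nrm (w - completion_emb Vc u) < e.
Proof.
move=> e0; have se0 : 0 < sof k e by rewrite -(sof0 R k) ltr_sof.
have [|v [wv [u _ uv]]] := @completion_emb_dense _ Vc (ball w (sof k e)) _
  (ball_open _ _).
  by exists w; exact: ballxx.
by exists u; move: wv; rewrite -uv -ball_normE/= nrmE ltr_sof.
Qed.

Let closure_graph_total w : exists z, closure_graph w z.
Proof.
have [lT [M' TM']] := bT; pose M := `|M'| + 1.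
have M0 : 0 < M by rewrite ltr_wpDl.
have TM v : nrm (T v) <= M * nrm v.
  rewrite (le_trans (TM' v))// ler_wpM2r ?nrm_ge0//.
  by rewrite (le_trans (ler_norm _))// lerDl.
have i0 n : 0 < (n.+1%:R : R)^-1 by rewrite invr_gt0.
have [u uw] := choice (fun n : nat => approx w (i0 n)).
have uu n m : nrm (T (u n) - T (u m)) <= M * (n.+1%:R^-1 + m.+1%:R^-1).
  rewrite -(linB lT) (le_trans (TM _))// ler_wpM2l ?(ltW M0)// -emb_nrmB.
  by rewrite (le_trans (nrmBD _ w _))// lerD// ?[nrm (_ - w)]nrmBC ltW.
have small (e : R) : 0 < e -> \forall n \near \oo, (n.+1%:R : R)^-1 < e.
  move=> e0; have /cvgrPdist_lt/(_ _ e0) := @cvg_harmonic R.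
  by apply: filterS => n; rewrite sub0r normrN ger0_norm// /harmonic/= invr_ge0.
have /cauchy_cvgP/cvg_ex[/= z Tuz] : cauchy ((T \o u) n @[n --> \oo]).
  apply/cauchy_ballP => e e0; near=> xy; rewrite -ball_normE/=.
  near: xy.
  have re0 : 0 < sre e / M / 2.
    by rewrite !divr_gt0// -(ltr_sof k) sof0 sreK// ltW.
  exists ((T \o u) @` [set n | n.+1%:R^-1 < sre e / M / 2],
          (T \o u) @` [set n | n.+1%:R^-1 < sre e / M / 2]) => /=.
    by split; apply: filterS (small _ re0) => n ?; exists n.
  move=> [_ _] /= [[n nP <-] [m mP <-]].
  rewrite nrmE -[ltRHS]sreK ?(ltW e0)// ltr_sof (le_lt_trans (uu _ _))//.
  by rewrite mulrC -ltr_pdivlMr// [ltRHS]splitr ltrD.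
exists z => e e0.
have se0 : 0 < sof k e by rewrite -(sof0 R k) ltr_sof.
near \oo => n; exists (u n).
  by rewrite (le_trans (ltW (uw n)))// ltW//; near: n; exact: small.
rewrite -(ler_sof k) -nrmE ltW//.
by near: n; move/cvgrPdist_lt : Tuz; apply.
Unshelve. all: by end_near. Qed.

Lemma bounded_op_extension :
  exists2 S : Vc -> W, bounded_op S & forall u, S (completion_emb Vc u) = T u.
Proof.
have [lT [M' TM']] := bT; pose M := `|M'|.
have M0 : 0 <= M by exact: normr_ge0.
have TM v : nrm (T v) <= M * nrm v.
  by rewrite (le_trans (TM' v))// ler_wpM2r ?nrm_ge0// ler_norm.
have bnd := closure_graph_bound M0 TM.
have uniq w z z' : closure_graph w z -> closure_graph w z' -> z = z'.
  move=> wz wz'; have := bnd _ _ (closure_graph_linear (-1) wz wz').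
  rewrite !scaleN1r addNr nrm0 mulr0 => zz'.
  apply/esym/subr0_eq; rewrite addrC; apply: nrm_eq0; apply/eqP.
  by rewrite eq_le zz' nrm_ge0.
have [S SP] := choice closure_graph_total.
exists S; last by move=> u; exact: uniq (SP _) (closure_graph_emb u).
split; last by exists M => w; exact: bnd.
by move=> a w w'; exact: uniq (SP _) (closure_graph_linear _ (SP _) (SP _)).
Qed.

Lemma bounded_op_extension_unique (S S' : Vc -> W) :
  bounded_op S -> bounded_op S' ->
  (forall u, S (completion_emb Vc u) = S' (completion_emb Vc u)) -> S = S'.
Proof.
move=> /bounded_opP[_ cS] /bounded_opP[_ cS'] SS'; apply/funext => w.
apply/eqP; rewrite -subr_eq0; apply/eqP/nrm_eq0/eqP.
rewrite eq_le nrm_ge0 andbT; apply/ler_addgt0Pr => e e0; rewrite add0r.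
have se0 : 0 < sof k (e / 2) by rewrite -(sof0 R k) ltr_sof divr_gt0.
have /cvgrPdist_lt/(_ _ se0) nS := cS w.
have /cvgrPdist_lt/(_ _ se0) nS' := cS' w.
have : nbhs w ([set v | `|S w - S v| < sof k (e / 2)] `&`
               [set v | `|S' w - S' v| < sof k (e / 2)]) by exact: filterI.
rewrite -nbhs_ballE => -[d /= d0 dP].
have [|v [dv [u _ uv]]] := @completion_emb_dense _ Vc (ball w d) _
  (ball_open _ _).
  by exists w; exact: ballxx.
have [/=] := dP _ dv; rewrite -uv !nrmE !ltr_sof SS' => wS wS'.
rewrite (le_trans (nrmBD _ (S' (completion_emb Vc u)) _))// [leRHS]splitr.
by rewrite lerD ?ltW// nrmBC.
Qed.

End extension.
End completion.

Arguments completion_emb {R k V} _ _.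

Section box_map.
Context (R : realType) (k : scalar_kind).
Local Notation K := (scalars R k).
Variables (X Z : pointedMetricType R) (E F : normedModType K).

Definition map_rep (h : X -> Z) (T : E -> F) (s : seq (X * X * E)) :
  seq (Z * Z * F) := [seq (h t.1.1, h t.1.2, T t.2) | t <- s].

(* defined through a chosen representation of u; [box_map_rep] below shows
   that the choice is irrelevant *)
Definition box_map (h : X -> Z) (T : E -> F) (u : lip_tensor X E) :
  lip_tensor Z F := rep (map_rep h T (projT1 (cid (rep_surj u)))).

Section box_map_theory.
Variables (h : X -> Z) (T : E -> F).
Hypotheses (h0 : h point = point) (hL : exists L, lipschitz_map L h).
Hypothesis bT : bounded_op T.

Let adjoint_subproof (f : dual F) : (fun e => f (T e)) \in @dual_pred R k E.
Proof.
apply/asboolP; apply/bounded_opP; have [lf [M fM]] := dual_bounded f.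
have [lT [N TN]] := bT; split=> [a u v|]; first by rewrite lT lf.
exists (`|M| * `|N|) => v; rewrite (le_trans (fM _))//.
apply: (@le_trans _ _ (`|M| * nrm (T v))).
  by rewrite ler_wpM2r ?nrm_ge0// ler_norm.
rewrite -mulrA ler_wpM2l// (le_trans (TN v))//.
by rewrite ler_wpM2r ?nrm_ge0// ler_norm.
Qed.

Let adjoint (f : dual F) : dual E := Dual (adjoint_subproof f).

Let adjointB (f g : dual F) : adjoint (f - g) = adjoint f - adjoint g.
Proof. exact/val_inj/funext. Qed.

Let adjoint_le : exists2 M, 0 <= M &
  forall f : dual F, dual_norm (adjoint f) <= M * dual_norm f.
Proof.
have [lT [N TN]] := bT; exists `|N| => // f; apply: dual_norm_le => [e|].
  rewrite (le_trans (dual_norm_bound f (T e)))// [leRHS]mulrAC mulrC.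
  rewrite ler_wpM2r ?dual_norm_ge0//.
  by rewrite (le_trans (TN e))// ler_wpM2r ?nrm_ge0// ler_norm.
by rewrite mulr_ge0// dual_norm_ge0.
Qed.

Let pullback_subproof (f : lip0 Z (dual F)) :
  (fun x => adjoint (f (h x))) \in @lip0_pred R k X (dual E).
Proof.
have /asboolP[f0 [L fL]] := valP f; have [M hM] := hL.
have [N N0 aN] := adjoint_le.
apply/asboolP; split; first by rewrite h0 [f point]f0; apply/val_inj/funext.
exists (N * (`|L| * M)) => x y; rewrite -adjointB nrm_dualE (le_trans (aN _))//.
rewrite -!mulrA ler_wpM2l// -nrm_dualE (le_trans (fL _ _))//.
apply: (@le_trans _ _ (`|L| * mdist (h x) (h y))).
  by rewrite ler_wpM2r ?mdist_ge0// ler_norm.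
by rewrite ler_wpM2l//; exact: hM.
Qed.

Let pullback (f : lip0 Z (dual F)) : lip0 X (dual E) :=
  Lip0 (pullback_subproof f).

Let rep_map_rep (s : seq (X * X * E)) (f : lip0 Z (dual F)) :
  rep (map_rep h T s) f = rep s (pullback f).
Proof. by rewrite !repE big_map. Qed.

Let map_rep_weight (L N : R) (s : seq (X * X * E)) :
  lipschitz_map L h -> (forall v, nrm (T v) <= N * nrm v) ->
  rep_weight (map_rep h T s) <= `|L| * `|N| * rep_weight s.
Proof.
move=> hl TN; rewrite /rep_weight big_map mulr_sumr; apply: ler_sum => t _ /=.
rewrite mulrACA ler_pM ?mdist_ge0 ?nrm_ge0//.
  by rewrite (le_trans (hl _ _))// ler_wpM2r ?mdist_ge0// ler_norm.
by rewrite (le_trans (TN _))// ler_wpM2r ?nrm_ge0// ler_norm.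
Qed.

Let box_mapE (u : lip_tensor X E) (f : lip0 Z (dual F)) :
  box_map h T u f = u (pullback f).
Proof. by rewrite /box_map; case: cid => s /= <-; exact: rep_map_rep. Qed.

Lemma box_map_rep (s : seq (X * X * E)) :
  box_map h T (rep s) = rep (map_rep h T s).
Proof.
by apply/val_inj/val_inj/funext => f; rewrite [LHS]box_mapE -rep_map_rep.
Qed.

Lemma box_map_bounded : bounded_op (box_map h T).
Proof.
split=> [a u v|].
  apply/val_inj/val_inj/funext => f; rewrite [LHS]box_mapE.
  transitivity (a *: box_map h T u f + box_map h T v f); last by [].
  by rewrite !box_mapE.
have [L hl] := hL; have [_ [N TN]] := bT.
exists (`|L| * `|N|) => u; rewrite !nrm_lip_tensorE.
have [L0|L0] := eqVneq (`|L| * `|N|) 0; last first.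
  have Lp : 0 < `|L| * `|N| by rewrite lt_neqAle eq_sym L0 mulr_ge0.
  rewrite mulrC -ler_pdivrMr//; apply: le_lip_pi => s su; rewrite ler_pdivrMr//.
  rewrite mulrC -su box_map_rep (le_trans (lip_pi_le erefl))//.
  exact: map_rep_weight.
have [s <-] := rep_surj u; rewrite L0 mul0r box_map_rep.
rewrite (le_trans (lip_pi_le erefl))// -(mul0r (rep_weight s)) -L0.
exact: map_rep_weight.
Qed.

End box_map_theory.
End box_map.

Section box_pi.
Context (R : realType) (k : scalar_kind).
Local Notation K := (scalars R k).
Variables (X Z : pointedMetricType R) (E F : normedModType K).
Variables (XE : completion (lip_tensor X E)) (ZF : completion (lip_tensor Z F)).

(* the unique bounded linear extension of [box_map h T] to the completions;
   it exists by [box_piP] as soon as h is in Lip_0(X, Z) and T is bounded *)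
Definition box_pi (h : X -> Z) (T : E -> F) : XE -> ZF :=
  xget (fun=> 0) [set S : XE -> ZF | bounded_op S /\
    forall u, S (completion_emb XE u) = completion_emb ZF (box_map h T u)].

Lemma box_piP (h : X -> Z) (T : E -> F) :
  h point = point -> (exists L, lipschitz_map L h) -> bounded_op T ->
  bounded_op (box_pi h T) /\
  forall u, box_pi h T (completion_emb XE u) = completion_emb ZF (box_map h T u).
Proof.
move=> h0 hL bT; rewrite /box_pi.
have bS : bounded_op (completion_emb ZF \o box_map h T).
  have [lb [M bM]] := box_map_bounded h0 hL bT; split=> [a u v|].
    by rewrite /= lb completion_emb_linear.
  by exists M => u; rewrite /= completion_emb_isometry.
have [S bS' SE] := bounded_op_extension XE bS.
by case: xgetP => [S' _ []//|/(_ S)]; case; split.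
Qed.

Lemma box_pi_unique (h : X -> Z) (T : E -> F) (S : XE -> ZF) :
  h point = point -> (exists L, lipschitz_map L h) -> bounded_op T ->
  bounded_op S ->
  (forall u, S (completion_emb XE u) = completion_emb ZF (box_map h T u)) ->
  S = box_pi h T.
Proof.
move=> h0 hL bT bS SE; have [bP PE] := box_piP h0 hL bT.
by apply: bounded_op_extension_unique => // u; rewrite SE PE.
Qed.

End box_pi.

Arguments box_pi {R k X Z E F} XE ZF h T.

(* Main.v *)
Require Import Defs.
From mathcomp Require Import all_boot all_order all_algebra.
From mathcomp Require Import boolp classical_sets functions reals.
From mathcomp Require Import topology normedtype sequences.
From mathcomp Require Import interval_inference lra.

Import Order.TTheory GRing.Theory Num.Theory.
Import numFieldNormedType.Exports.

Local Open Scope ring_scope.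

(** Call a map between normed spaces almost norm-lifting when every target
    vector w has, for each e > 0, a preimage of norm at most |w| + e.  A bounded
    operator is a quotient operator exactly when it is a contraction and almost
    norm-lifting, so both properties have to be carried from q and Q to the
    completed tensor product.

    On the algebraic tensor products this is a computation with
    representations.  Since q is 1-Lipschitz and Q is a contraction, mapping a
    representation termwise does not increase its weight, so the tensor map is
    a contraction for pi.  Conversely, co-Lipschitzness with every constant
    C > 1 lets q lift a pair of points with arbitrarily small loss of distance
    ([co_lipschitz_lift_pair]), and Q lifts a vector with arbitrarily small loss
    of norm; so a representation lifts termwise to one of almost the same weight
    ([map_rep_lift]).

    Passing to completions, the contraction property extends by density.  For
    almost norm-liftings, density only gives approximate preimages, that is
    vectors v of almost the right norm with S v close to w.  Correcting
    the error repeatedly, with errors decreasing geometrically, gives a Cauchy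
    sequence whose limit is an exact preimage, as in the proof of the open
    mapping theorem ([lift_of_approx_lift]). *)

(** * Bounded and quotient operators *)

Section operators.
Context {R : realType} {k : scalar_kind}.
Local Notation K := (scalars R k).

Lemma nrmB (V : normedModType K) (v w : V) : nrm (v - w) = nrm (w - v).
Proof. by rewrite -nrmN opprB. Qed.

Lemma nrm_triangle (V : normedModType K) (u v w : V) :
  nrm (u - w) <= nrm (u - v) + nrm (v - w).
Proof. by rewrite (le_trans _ (nrmD _ _))// addrA subrK. Qed.

Lemma bounded_opB {V W : normedModType K} {f : V -> W} u v :
  bounded_op f -> f (u - v) = f u - f v.
Proof. by move=> [lf _]; rewrite addrC -scaleN1r lf scaleN1r addrC. Qed.

Lemma bounded_opD {V W : normedModType K} {f : V -> W} u v :
  bounded_op f -> f (u + v) = f u + f v.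
Proof. by move=> [lf _]; rewrite -[u in LHS]scale1r lf scale1r. Qed.

Lemma bounded_op_gt0 {V W : normedModType K} {f : V -> W} : bounded_op f ->
  exists2 M : R, 0 < M & forall v, nrm (f v) <= M * nrm v.
Proof.
move=> [_ [M fM]]; exists (`|M| + 1) => [|v]; first by rewrite ltr_wpDl.
rewrite (le_trans (fM v))// ler_wpM2r ?nrm_ge0//.
by rewrite (le_trans (ler_norm M))// lerDl.
Qed.

Lemma quotient_operator_contraction {V W : normedModType K} {f : V -> W} :
  quotient_operator f -> forall v, nrm (f v) <= nrm v.
Proof.
move=> [_ _ fE] v; rewrite fE; apply: ge_inf; last by exists v.
by exists 0 => _ [u _ <-]; exact: nrm_ge0.
Qed.

Lemma quotient_operator_lift {V W : normedModType K} {f : V -> W} :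
  quotient_operator f -> forall w (e : R), 0 < e ->
  exists2 v, f v = w & nrm v <= nrm w + e.
Proof.
move=> [_ fs fE] w e e0.
have [||_ [v /= fv <-] ve] :=
  @inf_adherent R [set nrm v | v in [set v | f v = w]]%classic e => //.
  split; last by exists 0 => _ [u _ <-]; exact: nrm_ge0.
  by have [v _ fv] := fs w I; exists (nrm v), v.
by exists v; rewrite // fE ltW.
Qed.

Lemma quotient_operatorI {V W : normedModType K} {f : V -> W} :
  bounded_op f -> (forall v, nrm (f v) <= nrm v) ->
  (forall w (e : R), 0 < e -> exists2 v, f v = w & nrm v <= nrm w + e) ->
  quotient_operator f.
Proof.
move=> bf fle lift; split=> // [w _|w].
  by have [v fv _] := lift w 1 ltr01; exists v.
apply/eqP; rewrite eq_le; apply/andP; split.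
  apply: lb_le_inf => [|_ [v /= <- <-]]; last exact: fle.
  by have [v fv _] := lift w 1 ltr01; exists (nrm v), v.
apply/ler_addgt0Pr => e /(lift w)[v fv ve]; rewrite (le_trans _ ve)//.
apply: ge_inf; last by exists v.
by exists 0 => _ [u _ <-]; exact: nrm_ge0.
Qed.

(** * Exact preimages from approximate ones *)

Lemma geometric_small {c e : R} : 0 <= c -> 0 < e ->
  exists n, c / 2 ^+ n < e.
Proof.
move=> c0 e0; have c1 : 0 < c + 1 by rewrite ltr_wpDl.
have d0 : 0 < e / (c + 1) by rewrite divr_gt0.
have [n _ /(_ n (leqnn n))/=] := near_infty_natSinv_expn_lt (PosNum d0).
rewrite ltr_pdivlMr// mul1r => ne; exists n; rewrite (le_lt_trans _ ne)//.
by rewrite mulrC ler_wpM2l ?invr_ge0 ?exprn_ge0// lerDl.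
Qed.

(** The increments are bounded by those of a telescoping sum, which bounds the
    distance from the n-th term to all later ones, hence to the limit. *)
Lemma geometric_limit {V : completeNormedModType K} {x : nat -> V} {c : R} :
  0 <= c ->
  (forall n, nrm (x n.+1 - x n) <= c / 2 ^+ n - c / 2 ^+ n.+1) ->
  exists l, forall n, nrm (l - x n) <= c / 2 ^+ n.
Proof.
move=> c0 dx.
have tail n m : (n <= m)%N -> nrm (x m - x n) <= c / 2 ^+ n.
  move=> /subnK <-; set p := (m - n)%N.
  suff: nrm (x (p + n)%N - x n) <= c / 2 ^+ n - c / 2 ^+ (p + n).
    by move=> /le_trans; apply; rewrite gerBl divr_ge0// exprn_ge0.
  elim: p => [|p IH]; first by rewrite !subrr nrm0.
  rewrite (le_trans (nrm_triangle _ _ (x (p + n)%N) _))//.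
  by have := dx (p + n)%N; rewrite -addSn => dp; lra.
have sof_gt0 (e : R) : 0 < e -> 0 < sof k e by rewrite -(sof0 R k) ltr_sof.
have /cauchy_cvgP/cvg_ex[/= l xl] : cauchy (x n @[n --> \oo])%classic.
  apply: cauchy_exP => e e0.
  have e'0 : 0 < sre e by rewrite -(ltr_sof k) sof0 sreK// ltW.
  have [n ne] := geometric_small c0 e'0.
  exists (x n), n => // m /= nm; rewrite -ball_normE /= nrmE -[ltRHS]sreK ?ltW//.
  by rewrite ltr_sof nrmB (le_lt_trans (tail _ _ nm)).
exists l => n; apply/ler_addgt0Pr => e e0.
have /cvgrPdist_lt/(_ _ (sof_gt0 _ e0)) [N _ /= NP] := xl.
have := NP (maxn N n) (leq_maxl _ _); rewrite nrmE ltr_sof => lx.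
rewrite (le_trans (nrm_triangle _ _ (x (maxn N n)) _))// addrC.
by rewrite lerD ?tail ?leq_maxr// ltW.
Qed.

(** Successive approximation: the error left by x n is lifted approximately
    and added to x n, which halves the bound on the error; the norm of each
    increment is controlled by the error it corrects, so the increments add
    little to the norm of the first lift. *)
Lemma lift_of_approx_lift (V : completeNormedModType K) (W : normedModType K)
    (S : V -> W) : bounded_op S ->
  (forall w (e : R), 0 < e ->
     exists2 v, nrm (w - S v) <= e & nrm v <= nrm w + e) ->
  forall w (e : R), 0 < e -> exists2 v, S v = w & nrm v <= nrm w + e.
Proof.
move=> bS approx w e e0.
have {}approx (we : W * R) : exists v, 0 < we.2 ->
    nrm (we.1 - S v) <= we.2 /\ nrm v <= nrm we.1 + we.2.
  have [e'0|_] := ltP 0 we.2; last by exists 0.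
  by have [v] := approx we.1 _ e'0; exists v.
have [L LP] := choice approx.
(* The first lift exceeds |w| by at most d, the later ones add at most 4 * d in total. *)
pose d := e / 5; have d0 : 0 < d by rewrite divr_gt0.
have dn0 n : 0 < d / 2 ^+ n by rewrite divr_gt0// exprn_gt0.
pose x := fix x n := if n is m.+1
  then x m + L (w - S (x m), d / 2 ^+ m.+1) else L (w, d).
have [err0 nx0] := LP (w, d) d0.
have err n : nrm (w - S (x n)) <= d / 2 ^+ n.
  case: n => [|n]; first by rewrite expr0 divr1.
  rewrite /= (bounded_opD _ _ bS) opprD addrA.
  by have [] := LP (w - S (x n), d / 2 ^+ n.+1) (dn0 n.+1).
have half n : d / 2 ^+ n.+1 = d / 2 ^+ n / 2.
  by rewrite exprSr invfM mulrA.
have step n : nrm (x n.+1 - x n) <= 4 * d / 2 ^+ n - 4 * d / 2 ^+ n.+1.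
  have [_ /= nL] := LP (w - S (x n), d / 2 ^+ n.+1) (dn0 n.+1).
  rewrite /= addrC addKr -2!mulrA (le_trans nL)//.
  by have := err n; have := dn0 n; rewrite half; lra.
have c0 : 0 <= 4 * d by rewrite mulr_ge0// ltW.
have [l lx] := geometric_limit c0 step.
exists l; last first.
  have := lx 0%N; rewrite expr0 divr1 => l0.
  rewrite -[l](subrK (x 0%N)) (le_trans (nrmD _ _))//.
  by move: nx0 l0; rewrite /d /=; lra.
have [M M0 SM] := bounded_op_gt0 bS.
apply/eqP; rewrite eq_sym -subr_eq0; apply/eqP/nrm_eq0/eqP.
rewrite eq_le nrm_ge0 andbT; apply/ler_addgt0Pr => r r0; rewrite add0r.
have c'0 : 0 <= d + M * (4 * d) by rewrite addr_ge0 ?mulr_ge0// ltW.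
have [n nr] := geometric_small c'0 r0.
rewrite (le_trans _ (ltW nr))// mulrDl.
rewrite (le_trans (nrm_triangle _ _ (S (x n)) _))// lerD//.
rewrite -(bounded_opB _ _ bS) (le_trans (SM _))// -mulrA ler_pM2l//.
by rewrite nrmB.
Qed.

(** * Extension to completions *)

Lemma completion_approx {V : normedModType K} (Vc : completion V) (w : Vc)
  (e : R) : 0 < e -> exists u, nrm (w - completion_emb Vc u) < e.
Proof.
move=> e0; have se0 : 0 < sof k e by rewrite -(sof0 R k) ltr_sof.
have [|v [wv [u _ uv]]] := @completion_emb_dense _ _ _ Vc (ball w (sof k e)) _
  (ball_open _ _).
  by exists w; exact: ballxx.
by exists u; move: wv; rewrite -uv -ball_normE/= nrmE ltr_sof.
Qed.

Section extension.
Context {V W : normedModType K} {Vc : completion V} {Wc : completion W}.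
Context {T : V -> W} {S : Vc -> Wc}.
Hypothesis bS : bounded_op S.
Hypothesis SE : forall u, S (completion_emb Vc u) = completion_emb Wc (T u).

Lemma extension_contraction :
  (forall u, nrm (T u) <= nrm u) -> forall v, nrm (S v) <= nrm v.
Proof.
move=> Tle v; have [M M0 SM] := bounded_op_gt0 bS.
apply/ler_addgt0Pr => e e0.
have M1 : 0 < M + 1 by rewrite addr_gt0.
have d0 : 0 < e / (M + 1) by rewrite divr_gt0.
have [u vu] := completion_approx Vc v _ d0.
have Sv : nrm (S v) <= M * nrm (v - completion_emb Vc u) + nrm u.
  rewrite -[v in leLHS](subrK (completion_emb Vc u)) (bounded_opD _ _ bS).
  by rewrite (le_trans (nrmD _ _))// lerD// SE completion_emb_isometry.
have nu : nrm u <= nrm (v - completion_emb Vc u) + nrm v.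
  rewrite -(completion_emb_isometry Vc) nrmB.
  by rewrite -{1}[completion_emb Vc u](subrK v) (le_trans (nrmD _ _)).
move: vu Sv nu; rewrite ltr_pdivlMr//; set a := nrm (v - _) => vu Sv nu.
lra.
Qed.

(** A vector of the completion is approximated by one of the space, which is
    lifted in the uncompleted domain; completeness of the domain then turns
    this approximate lifting into an exact one. *)
Lemma extension_lift :
  (forall w (e : R), 0 < e -> exists2 u, T u = w & nrm u <= nrm w + e) ->
  forall w (e : R), 0 < e -> exists2 v, S v = w & nrm v <= nrm w + e.
Proof.
move=> lift; apply: lift_of_approx_lift => // w e e0.
have h0 : 0 < e / 2 by rewrite divr_gt0.
have [v wv] := completion_approx Wc w _ h0; have [u Tu nu] := lift v _ h0.
exists (completion_emb Vc u); first by rewrite SE Tu; lra.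
have nv : nrm v <= nrm w + nrm (w - completion_emb Wc v).
  rewrite -(completion_emb_isometry Wc) nrmB addrC.
  by rewrite -{1}[completion_emb Wc v](subrK w) nrmD.
rewrite completion_emb_isometry; lra.
Qed.

End extension.
End operators.

(** * Tensor products of quotient maps *)

(** Given z, z', any preimage x of z works; z' lies in the ball of radius
    d(z, z') + e / 2 around z, which is r / C for r = d(z, z') + e and a
    suitable C > 1, so it has a preimage in the ball of radius r around x. *)
Lemma co_lipschitz_lift_pair {R : realType} {X Z : metricType R} {q : X -> Z} :
  set_surj setT setT q -> (forall C : R, 1 < C -> co_lipschitz C q) ->
  forall z z' (e : R), 0 < e -> exists x x',
    [/\ q x = z, q x' = z' & mdist x x' <= mdist z z' + e].
Proof.
move=> qs qC z z' e e0; have [x _ qx] := qs z I.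
have d0 := mdist_ge0 z z'; set d := mdist z z' in d0 *.
have h0 : 0 < d + e / 2 by lra.
have r0 : 0 < d + e by lra.
have C1 : 1 < (d + e) / (d + e / 2) by rewrite ltr_pdivlMr// mul1r; lra.
have rC : (d + e) / ((d + e) / (d + e / 2)) = d + e / 2.
  by rewrite invf_div mulrCA mulfV ?mulr1// gt_eqF.
have := qC _ C1 x _ r0 z'; rewrite rC !ballEmdist /= qx -/d.
by case=> [|x' xx' qx']; [lra|exists x, x'; split=> //; exact: ltW].
Qed.

Lemma product_slack {R : realType} {a b e : R} : 0 <= a -> 0 <= b -> 0 < e ->
  exists2 d, 0 < d & (a + d) * (b + d) <= a * b + e.
Proof.
move=> a0 b0 e0; have c0 : 0 < a + b + 1 by lra.
exists (Num.min 1 (e / (a + b + 1))); first by rewrite lt_min ltr01 divr_gt0.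
set d := Num.min _ _.
have d0 : 0 <= d by rewrite le_min ler01 divr_ge0// ltW.
have d1 : d <= 1 by rewrite ge_min lexx.
have de : d * (a + b + 1) <= e by rewrite -ler_pdivlMr// ge_min lexx orbT.
have dd : d * d <= d by rewrite ler_piMr.
rewrite mulrDl !mulrDr; move: de; rewrite !mulrDr mulr1.
by rewrite (mulrC d a) addrA => de; lra.
Qed.

Section tensor.
Context {R : realType} {k : scalar_kind} {X Z : pointedMetricType R}.
Context {E F : normedModType (scalars R k)} {q : X -> Z} {Q : E -> F}.

Lemma map_rep_lift : set_surj setT setT q ->
  (forall C : R, 1 < C -> co_lipschitz C q) -> quotient_operator Q ->
  forall s (e : R), 0 < e ->
  exists2 s', map_rep q Q s' = s & rep_weight s' <= rep_weight s + e.
Proof.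
move=> qs qC qQ; rewrite /rep_weight; elim=> [|[[z z'] f] s IH] e e0.
  by exists [::]; rewrite // !big_nil ltW// add0r.
have h0 : 0 < e / 2 by rewrite divr_gt0.
have [s' s'E s'w] := IH _ h0.
have [d d0 dP] := product_slack (mdist_ge0 z z') (nrm_ge0 f) h0.
have [x [x' [qx qx' xx']]] := co_lipschitz_lift_pair qs qC z z' _ d0.
have [v Qv vf] := quotient_operator_lift qQ f _ d0.
exists ((x, x', v) :: s'); first by rewrite /= qx qx' Qv s'E.
have xv : mdist x x' * nrm v <= (mdist z z' + d) * (nrm f + d).
  by rewrite ler_pM ?mdist_ge0 ?nrm_ge0.
rewrite !big_cons /=; lra.
Qed.

Hypotheses (q0 : q point = point) (qL : lipschitz_map 1 q).
Hypothesis qQ : quotient_operator Q.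

Lemma box_map_contraction (u : lip_tensor X E) :
  nrm (box_map q Q u) <= nrm u.
Proof.
have [bQ _ _] := qQ; rewrite !nrm_lip_tensorE; apply: le_lip_pi => s <-.
rewrite (box_map_rep q0 (ex_intro _ 1 qL) bQ) (le_trans (lip_pi_le erefl))//.
rewrite /rep_weight big_map; apply: ler_sum => t _ /=.
rewrite ler_pM ?mdist_ge0 ?nrm_ge0//; first by rewrite -[leRHS]mul1r; exact: qL.
exact: quotient_operator_contraction.
Qed.

Lemma box_map_lift : set_surj setT setT q ->
  (forall C : R, 1 < C -> co_lipschitz C q) ->
  forall (v : lip_tensor Z F) (e : R), 0 < e ->
  exists2 u, box_map q Q u = v & nrm u <= nrm v + e.
Proof.
move=> qs qC v e e0; have [bQ _ _] := qQ.
have h0 : 0 < e / 2 by rewrite divr_gt0.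
have [|_ [s sv <-] sw] :=
  @inf_adherent R [set rep_weight s | s in [set s | rep s = v]]%classic _ h0.
  split; first by have [s sv] := rep_surj v; exists (rep_weight s), s.
  by exists 0 => _ [s _ <-]; exact: rep_weight_ge0.
have [s' s's s'w] := map_rep_lift qs qC qQ s _ h0.
exists (rep s').
  by rewrite (box_map_rep q0 (ex_intro _ 1 qL) bQ) s's.
rewrite !nrm_lip_tensorE (le_trans (lip_pi_le erefl))//.
by move: sw; rewrite -/(lip_pi v); lra.
Qed.

End tensor.

Theorem theorem6p10 (R : realType) (k : scalar_kind)
  (X Z : pointedMetricType R) (q : X -> Z)
  (E F : completeNormedModType (scalars R k)) (Q : E -> F)
  (XE : completion (lip_tensor X E)) (ZF : completion (lip_tensor Z F)) :
  q point = point ->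
  lipschitz_quotient q ->
  lipschitz_map 1 q ->
  (forall C : R, 1 < C -> co_lipschitz C q) ->
  quotient_operator Q ->
  quotient_operator (box_pi XE ZF q Q).
Proof.
move=> q0 [qs _ _] qL qC qQ; have [bQ _ _] := qQ.
have [bS SE] := box_piP XE ZF q0 (ex_intro _ 1 qL) bQ.
apply: quotient_operatorI => //.
- by apply: (extension_contraction bS SE); exact: box_map_contraction.
- by apply: (extension_lift bS SE); exact: box_map_lift.
Qed.
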